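(* Let $\mathcal{DG}=\{\mathcal{V},\mathcal{E}\}$ and $\mathcal{DG}'=\{\mathcal{V}',\mathcal{E}'\}$ be two dynamic graphs with node features $\mathbf{X}$ and $\mathbf{X}'$ respectively. Let $l$ be a labeling of the nodes of both graphs by natural numbers such that, for all $u\in\mathcal{V}$ and $v\in\mathcal{V}'$, $l(u)=l(v)$ if and only if $\mathbf{X}_u=\mathbf{X}'_v$. Let $t$ be a time, let $c_t^{(j)}$ denote the color at time $t$ obtained by the 1-DWL test initialized with $l$ at the $j$-th iteration, and let $h_t^{(j)}$ denote the $j$-th layer temporal node embeddings output by a DyGNN (the same DyGNN applied to both graphs). Then for all $j\ge 0$ and all $u\in\mathcal{V}$, $v\in\mathcal{V}'$, $$c_t^{(j)}(u)=c_t^{(j)}(v)\ \Longrightarrow\ h_t^{(j)}(u)=h_t^{(j)}(v).$$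
   Context: Dynamic graph: $\mathcal{DG}=\{\mathcal{V},\mathcal{E}\}$ with $\mathcal{V}$ a finite node set and $\mathcal{E}=\{(u_1,v_1,t_1),(u_2,v_2,t_2),\dots\}$ a finite sequence of interactions with real timestamps $t_i\le t_{i+1}$; $(u_i,v_i,t_i)$ means nodes $u_i$ and $v_i$ interact at time $t_i$. Interactions are undirected, and the same pair may interact several times. Node features form a matrix $\mathbf{X}\in\mathbb{R}^{|\mathcal{V}|\times d_N}$ with row $\mathbf{X}_u$ for node $u$ (same $d_N$ for both graphs). Historical neighbors: $\mathcal{N}(u,t)=\{(w,t') : t'<t,\ (u,w,t')\in\mathcal{E}\ \text{or}\ (w,u,t')\in\mathcal{E}\}$. Dynamic Adjacency Tensor (DAT): $\mathsf{A}$ is indexed by $\mathcal{V}\times\mathcal{V}\times\{1,\dots,T\}$, where $\mathsf{A}_{u,v,:}=[t_1,\dots,t_{q(u,v)},\infty,\dots,\infty]$ lists in nondecreasing order the timestamps of the $q(u,v)$ interactions between $u$ and $v$, padded by $\infty$ to length $T$. Thus $\mathsf{A}_{u,v,:}=\mathsf{A}_{v,u,:}$. $T$ is at least the maximum interaction count of any pair, and a common $T$ is used for the two graphs being compared. Historical DAT: $\mathsf{A}^{<t}_{i,j,k}=\mathsf{A}_{i,j,k}$ if $\mathsf{A}_{i,j,k}<t$, and $\infty$ otherwise. $\{\!\!\{\cdot\}\!\!\}$ denotes a multiset, $\|$ denotes concatenation; $\mathrm{HASH}$ is an injective function of its arguments, the same for both graphs. 1-DWL test at time $t$: $c_t^{(0)}(u)=l(u)$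 and for $j>0$ $$c_t^{(j)}(u)=\mathrm{HASH}\big(c_t^{(j-1)}(u),\ \{\!\!\{(c_t^{(j-1)}(v),\mathsf{A}^{<t}_{u,v,:}) : (v,\cdot)\in\mathcal{N}(u,t)\}\!\!\}\big).$$ DyGNN: given functions $\mathrm{AGG}$ (on multisets of vectors), $\mathrm{UPDATE}$ (on pairs of vectors) and $\sigma:\mathbb{R}^+\to\mathbb{R}^{d_T}$, the embeddings at every time $t$ are $h_t^{(0)}(u)=\mathbf{X}_u$ and for $l>0$ $$\tilde h_t^{(l)}(u)=\mathrm{AGG}\big(\{\!\!\{[h_{t'}^{(l-1)}(w)\,\|\,\sigma(t-t')] : (w,t')\in\mathcal{N}(u,t)\}\!\!\}\big),\qquad h_t^{(l)}(u)=\mathrm{UPDATE}\big(h_t^{(l-1)}(u),\tilde h_t^{(l)}(u)\big).$$ *)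

(* Defs.v *)
From HB Require Import structures.
From mathcomp Require Import all_boot all_order all_algebra.
From mathcomp Require Import finmap multiset.
From mathcomp Require Import reals constructive_ereal.

Set Implicit Arguments.
Unset Strict Implicit.
Unset Printing Implicit Defensive.

Import Order.TTheory GRing.Theory Num.Theory.
Local Open Scope ring_scope.
Local Open Scope fset_scope.
Local Open Scope mset_scope.

(* Each interaction (u, v, t) is listed in one arbitrary orientation; every notion
   below treats (u, v, t) and (v, u, t) alike. *)
Record dyn_graph (R : realType) (V : finType) := DynGraph {
  events :> seq (V * V * R);
  _ : sorted <=%R [seq e.2 | e <- events] }.

Section DynGraph.
Context {R : realType} {V : finType}.
Implicit Types (G : dyn_graph R V) (u v w : V) (t : R).

(* The first comprehension only bounds the set-builder by a finite set; see
   in_hist_nbrs. *)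
Definition hist_nbrs G u t : {fset V * R} :=
  [fset p in [seq (w, e.2) | w <- enum V, e <- events G]
     | (p.2 < t) && (((u, p.1, p.2) \in events G) || ((p.1, u, p.2) \in events G))].

Lemma in_hist_nbrs G u t w t' :
  ((w, t') \in hist_nbrs G u t) =
  (t' < t) && (((u, w, t') \in events G) || ((w, u, t') \in events G)).
Proof.
rewrite /hist_nbrs !inE /=; apply: andb_idl => /andP[_ h].
apply/allpairsP; case/orP: h => h; [exists (w, (u, w, t')) | exists (w, (w, u, t'))];
  by split; rewrite ?mem_enum.
Qed.

Definition hist_nbr_nodes G u t : {set V} :=
  [set w in [seq p.1 | p <- hist_nbrs G u t]].

(* Nondecreasing, because events is sorted by timestamp. An interaction (u, u, t) is
   listed once in times G u u. *)
Definition times G u v : seq R :=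
  [seq e.2 | e <- events G & (e.1 == (u, v)) || (e.1 == (v, u))].

(* The padded list only has all its timestamps when size (times G u v) <= T. *)
Definition dat G (T : nat) u v : T.-tuple (\bar R) :=
  [tuple nth +oo%E [seq s%:E%E | s <- times G u v] k | k < T].

Definition hist_dat G (T : nat) t u v : T.-tuple (\bar R) :=
  [tuple of [seq (if (a < t%:E)%E then a else +oo%E) | a <- dat G T u v]].

(* Colors live in an arbitrary type C into which the natural number labels embed by
   iota: an injective HASH cannot take its values in nat, since its arguments contain
   arbitrary real timestamps. The multiset has one element per historical neighbor v,
   the multiplicity of the interactions with v being recorded in hist_dat. *)
Fixpoint dwl_color (C : choiceType) (T : nat) (iota : nat -> C)
    (HASH : C -> {mset C * T.-tuple (\bar R)} -> C)
    G (lab : V -> nat) t (j : nat) u : C :=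
  if j is i.+1 then
    HASH (dwl_color iota HASH G lab t i u)
      (seq_mset [seq (dwl_color iota HASH G lab t i v, hist_dat G T t u v)
                | v in hist_nbr_nodes G u t])
  else iota (lab u).

End DynGraph.

(* Vector dimensions are part of the types, so AGG and UPDATE are given layer by layer,
   for layers of arbitrary widths; width 0 is the node feature dimension. sigma is only
   ever evaluated at positive reals. *)
Record dygnn (R : realType) := DyGNN {
  width : nat -> nat;
  agg_width : nat -> nat;
  time_width : nat;
  AGG : forall l, {mset 'rV[R]_(width l + time_width)} -> 'rV[R]_(agg_width l);
  UPDATE : forall l, 'rV[R]_(width l) -> 'rV[R]_(agg_width l) -> 'rV[R]_(width l.+1);
  sigma : R -> 'rV[R]_time_width }.

(* Rows of the feature matrix are indexed by the nodes through enum_rank. *)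
Fixpoint embedding {R : realType} {V : finType} (M : dygnn R) (G : dyn_graph R V)
    (X : 'M[R]_(#|V|, width M 0)) (l : nat) (t : R) (u : V) : 'rV[R]_(width M l) :=
  if l is k.+1 return 'rV[R]_(width M l) then
    UPDATE (embedding G X k t u)
      (AGG (seq_mset [seq row_mx (embedding G X k p.2 p.1) (sigma M (t - p.2))
                     | p <- hist_nbrs G u t]))
  else row (enum_rank u) X.

(* Main.v *)
(* The historical DAT row of a pair of nodes at time t determines the row at every
   earlier time, and it determines whether the two nodes are historical neighbors. Hence
   equal colors at time t give equal colors at all times s <= t, which is what the
   embeddings h_s of the past neighbors require; moreover the multiset of historical
   neighbors, with their timestamps, is recovered from the DAT rows of the neighbor nodes. *)
Require Import Defs.
From mathcomp Require Import all_boot all_order all_algebra.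
From mathcomp Require Import finmap multiset.
From mathcomp Require Import reals constructive_ereal.

Set Implicit Arguments.
Unset Strict Implicit.
Unset Printing Implicit Defensive.

Import Order.TTheory GRing.Theory Num.Theory.
Local Open Scope ring_scope.
Local Open Scope mset_scope.

(** Induction on [s]: the head [x] is paired with some [x'] of [s'] having the same key, and both
    are removed. It transfers an equality of multisets of keys to whatever the keys determine,
    across two different node sets. *)
Lemma perm_flatten_map (A A' : eqType) (B D : eqType)
    (f : A -> B) (f' : A' -> B) (g : A -> seq D) (g' : A' -> seq D) s s' :
  perm_eq (map f s) (map f' s') ->
  {in s & s', forall x x', f x = f' x' -> perm_eq (g x) (g' x')} ->
  perm_eq (flatten (map g s)) (flatten (map g' s')).
Proof.
elim: s s' => [|x s IH] s' /=.
  by move=> /perm_size; rewrite size_map; case: s'.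
move=> eq_f fg.
have /mapP[x' x's' fx] : f x \in map f' s' by rewrite -(perm_mem eq_f) mem_head.
have eq_s' := perm_to_rem x's'.
have /permPr -> : perm_eq (flatten (map g' s')) (flatten (map g' (x' :: rem x' s'))).
  exact/perm_flatten/perm_map.
rewrite /= perm_cat ?fg ?mem_head//; apply: IH => [|y y' ys y's'].
  by rewrite -(perm_cons (f x)) (permPl eq_f) fx -(map_cons f') perm_map.
by apply: fg; [rewrite inE ys orbT | apply: mem_rem y's'].
Qed.

Lemma map_filter_flatten (A D : Type) (f : A -> D) (p : pred A) (s : seq A) :
  map f (filter p s) = flatten [seq if p x then [:: f x] else [::] | x <- s].
Proof. by elim: s => //= x s <-; case: (p x). Qed.

Definition real_entries (R : realType) (r : seq (\bar R)) : seq R :=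
  pmap (fun a => if a is s%:E%E then Some s else None) r.

Lemma mem_real_entries (R : realType) (r : seq (\bar R)) s :
  (s \in real_entries r) = (s%:E%E \in r).
Proof.
rewrite mem_pmap; apply/mapP/idP => [[[s'||]// r_s' [->]]//|r_s].
by exists s%:E%E.
Qed.

Section HistoricalTimes.
Context {R : realType} {V : finType}.
Implicit Types (G : dyn_graph R V) (u w : V) (s t : R) (T : nat).

Lemma mem_times G u w s :
  (s \in times G u w) = ((u, w, s) \in events G) || ((w, u, s) \in events G).
Proof.
apply/mapP/orP => [[[[a b] s'] /=]|[] Ge].
- by rewrite mem_filter /= => /andP[/orP[] /eqP[-> ->] Ge ->]; [left|right].
- by exists (u, w, s) => //; rewrite mem_filter eqxx.
- by exists (w, u, s) => //; rewrite mem_filter /= eqxx orbT.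
Qed.

Lemma mem_dat G T u w s : (size (times G u w) <= T)%N ->
  (s%:E%E \in dat G T u w) = (s \in times G u w).
Proof.
move=> leT; apply/mapP/idP => [[k _]|Gs].
  case: (ltnP k (size (times G u w))) => hk.
    by rewrite (nth_map 0)// => -[->]; apply: mem_nth.
  (* Beyond the recorded timestamps the entry is the padding [+oo], which is not a real. *)
  by rewrite nth_default// size_map.
have hi : (index s (times G u w) < size (times G u w))%N by rewrite index_mem.
exists (Ordinal (leq_trans hi leT)); first by rewrite mem_enum.
by rewrite (nth_map 0)//= nth_index.
Qed.

Lemma mem_hist_dat G T t u w s : (size (times G u w) <= T)%N ->
  (s%:E%E \in hist_dat G T t u w) = ((w, s) \in hist_nbrs G u t).
Proof.
move=> leT; rewrite in_hist_nbrs -mem_times -(mem_dat _ leT).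
apply/mapP/andP => [[a Ga]|[st Gs]]; last by exists s%:E%E; rewrite ?lte_fin ?st.
by case: ifP => // at_ sa; move: Ga at_; rewrite -sa lte_fin.
Qed.

(** An entry already masked at [t] is at least [t], hence at least [s], and is masked at [s] too. *)
Lemma hist_dat_le G T s t u w : s <= t ->
  hist_dat G T s u w =
  [tuple of [seq (if (a < s%:E)%E then a else +oo%E) | a <- hist_dat G T t u w]].
Proof.
move=> st; apply/val_inj; rewrite /= -[RHS]map_comp; apply: eq_map => a /=.
case: (ltP a t%:E%E) => // ta.
by rewrite [(a < s%:E)%E]ltNge (le_trans _ ta) ?lee_fin.
Qed.

Lemma mem_hist_nbr_nodes G T t u w : (size (times G u w) <= T)%N ->
  (w \in hist_nbr_nodes G u t) = (real_entries (hist_dat G T t u w) != [::]).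
Proof.
move=> leT; rewrite inE; apply/mapP/idP => [[[w' s] Gs /= ww']|].
  rewrite -ww' -(mem_hist_dat _ _ leT) -mem_real_entries in Gs.
  by case: (real_entries _) Gs.
case Er: (real_entries _) => [//|s r] _.
by exists (w, s); rewrite //= -(mem_hist_dat _ _ leT) -mem_real_entries Er mem_head.
Qed.

(** The filter reads only the row at [s], itself a function of the row at [t], so the neighbors at
    [s] can be selected from the data that the colors at [t] contain. *)
Lemma enum_hist_nbr_nodes_le G T s t u : (forall w, size (times G u w) <= T)%N ->
  s <= t ->
  enum (hist_nbr_nodes G u s) =
  [seq w <- enum (hist_nbr_nodes G u t) | real_entries (hist_dat G T s u w) != [::]].
Proof.
move=> leT st; rewrite /enum_mem -filter_predI.
apply: eq_filter => w /=; rewrite -mem_hist_nbr_nodes//; apply/idP/andP => [ws|[]//].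
split=> //; move: ws; rewrite !inE => /mapP[[w' r] /= Gr ->].
apply/mapP; exists (w', r) => //; move: Gr; rewrite !in_hist_nbrs => /andP[rs ->].
by rewrite (lt_le_trans rs).
Qed.

(** [undup] is there because [hist_nbrs] is a set, while a DAT row repeats a timestamp at which the
    same pair interacts several times. *)
Lemma perm_hist_nbrs G T t u : (forall w, size (times G u w) <= T)%N ->
  perm_eq (hist_nbrs G u t)
    [seq (w, s) | w <- enum (hist_nbr_nodes G u t),
                  s <- undup (real_entries (hist_dat G T t u w))].
Proof.
move=> leT; apply: uniq_perm.
- exact: fset_uniq.
- apply: allpairs_uniq_dep; rewrite ?enum_uniq//.
    by move=> w _; apply: undup_uniq.
  by move=> [w s] [w1 s1] _ _ /= [-> ->].
- move=> [w s]; apply/idP/allpairsPdep => [Gs|[w' [s' [_ + [-> ->]]]]]; last first.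
    by rewrite mem_undup mem_real_entries mem_hist_dat.
  exists w, s; split=> //; last by rewrite mem_undup mem_real_entries mem_hist_dat.
  by rewrite mem_enum inE; apply/mapP; exists (w, s).
Qed.

End HistoricalTimes.

(** Induction on [j]: injectivity of [HASH] recovers the multiset of pairs at [t]. Each pair
    determines whether its node is a neighbor at [s], its row at [s] and, by induction, its color at
    [s]. *)
Lemma dwl_color_le (R : realType) (V V' : finType)
    (G : dyn_graph R V) (G' : dyn_graph R V') (lab : V -> nat) (lab' : V' -> nat)
    (T : nat)
    (hT : forall u w, (size (times G u w) <= T)%N)
    (hT' : forall u w, (size (times G' u w) <= T)%N)
    (C : choiceType) (iota : nat -> C)
    (HASH : C -> {mset C * T.-tuple (\bar R)} -> C) (hHASH : injective2 HASH)
    (s t : R) (j : nat) (u : V) (v : V') : s <= t ->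
  dwl_color iota HASH G lab t j u = dwl_color iota HASH G' lab' t j v ->
  dwl_color iota HASH G lab s j u = dwl_color iota HASH G' lab' s j v.
Proof.
move=> st; elim: j u v => [//|j IHj] u v /= /hHASH[/IHj -> /eq_seq_msetP eq_nbrs].
congr HASH; apply/eq_seq_msetP; rewrite /image_mem in eq_nbrs *.
rewrite !(@enum_hist_nbr_nodes_le _ _ _ T s t)//.
(* Each neighbor at [t] contributes a block of one pair or none, according to whether it is a
   neighbor at [s]. *)
rewrite [map _ _]map_filter_flatten [X in perm_eq _ X]map_filter_flatten.
apply: (perm_flatten_map eq_nbrs) => w w' _ _ /pair_equal_spec[/IHj eq_c eq_r].
by rewrite !(hist_dat_le _ _ _ _ st) eq_r eq_c.
Qed.

Theorem proposition2 (R : realType) (V V' : finType)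
    (G : dyn_graph R V) (G' : dyn_graph R V') (M : dygnn R)
    (X : 'M[R]_(#|V|, width M 0)) (X' : 'M[R]_(#|V'|, width M 0))
    (lab : V -> nat) (lab' : V' -> nat)
    (hlab : forall (u : V) (v : V'),
       lab u = lab' v <-> row (enum_rank u) X = row (enum_rank v) X')
    (T : nat)
    (hT : forall u v : V, (size (times G u v) <= T)%N)
    (hT' : forall u v : V', (size (times G' u v) <= T)%N)
    (C : choiceType) (iota : nat -> C) (hiota : injective iota)
    (HASH : C -> {mset C * T.-tuple (\bar R)} -> C) (hHASH : injective2 HASH)
    (t : R) (j : nat) (u : V) (v : V') :
  dwl_color iota HASH G lab t j u = dwl_color iota HASH G' lab' t j v ->
  embedding G X j t u = embedding G' X' j t v.
Proof.
(* The time is generalized because a layer at [t] reads the previous layer at earlier times. *)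
elim: j t u v => [|j IHj] t u v; first by move=> /hiota/hlab.
move=> /= /hHASH[/IHj -> /eq_seq_msetP eq_nbrs].
congr (UPDATE _ (AGG _)); apply/eq_seq_msetP.
have Pu := perm_hist_nbrs t (hT u); have Pv := perm_hist_nbrs t (hT' v).
(* The messages are grouped by neighbor node, one block per pair of a color and a row. *)
rewrite (permPl (perm_map _ Pu)) (permPr (perm_map _ Pv)) !map_allpairs.
apply: perm_flatten_map eq_nbrs _ => w w' _ _ /pair_equal_spec[eq_c eq_r].
rewrite eq_r; apply/permP => p; congr count; apply/eq_in_map => s.
rewrite mem_undup mem_real_entries -eq_r mem_hist_dat// in_hist_nbrs => /andP[/ltW st _].
(* The colors of [w] and [w'] agree at [t], hence at [s < t], where the induction hypothesis is
   applied. *)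
by rewrite (IHj s w w')//; apply: dwl_color_le eq_c.
Qed.
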